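(* Let $d\ge1$, $s,L>0$ and let $\psi:\mathbb{R}^d\to\mathbb{R}^d$ be admissible (defined in the context). Then there exists a convex cost function $k:\mathbb{R}^d\to[0,+\infty]$ such that the equation $u_t=\operatorname{div}\big(s\,u\,\psi(L\nabla u/u)\big)$ can be recast as $$u_t=\operatorname{div}\big(u\,\nabla k^*(L\nabla u/u)\big),$$ i.e. $s\,\psi(r)=\nabla k^*(r)$ for all $r\in\mathbb{R}^d$, where $k^*$ is the Legendre transform of $k$. Furthermore, $k$ is finite on $\{v\in\mathbb{R}^d:|v|<s\}$ and assumes the value $+\infty$ on $\{v\in\mathbb{R}^d:|v|>s\}$. Provided that the function $\delta$ in condition (3) of admissibility is integrable, $k$ is also finite on $\{v\in\mathbb{R}^d:|v|=s\}$.
   Context: **Admissible $\psi$.** $\psi:\mathbb{R}^d\to\mathbb{R}^d$ is admissible if: (1) $\psi\in C^1(\mathbb{R}^d,\mathbb{R}^d)$; (2) $\psi(0)=0$; (3) there is a continuous $\delta:[0,\infty)\to[0,\infty)$ with $\lim_{r\to\infty}\delta(r)=0$ and $|\psi(r)-r/|r||\le\delta(|r|)$ for all $r\in\mathbb{R}^d\setminus\{0\}$; (4) if $d=1$: $\psi$ is odd and monotonically increasing, and $|\psi'(r)|=o(1/|r|)$ as $|r|\to\infty$; if $d>1$: $\psi$ is a conservative vector field, $\psi(-r)=-\psi(r)$ for all $r$, the Jacobian matrix $D\psi$ is a (symmetric) non-negative definite matrix at every point, and $\|D\psi\|_\infty(r)=O(1/|r|)$ as $|r|\to\infty$. The Legendre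 transform is $k^*(p)=\sup_{v\in\mathbb{R}^d}\big(p\cdot v-k(v)\big)$. *)

(* Defs.v *)
From HB Require Import structures.
From mathcomp Require Export all_boot all_order all_algebra.
From mathcomp Require Export all_classical all_reals all_analysis.
Export Order.TTheory GRing.Theory Num.Theory.
Export numFieldNormedType.Exports.

#[export] Set Implicit Arguments.
#[export] Unset Strict Implicit.
#[export] Unset Printing Implicit Defensive.

Local Open Scope classical_set_scope.
Local Open Scope ring_scope.

Section Euclidean.
Context {R : realType} {d : nat}.
Implicit Types u v : 'rV[R]_d.

Definition dotp u v : R := \sum_(i < d) u 0 i * v 0 i.

(* The library norm `|v| on 'rV[R]_d is the sup norm, hence this definition;
   both induce the library topology and differential. *)
Definition enorm v : R := Num.sqrt (dotp v v).

(* The filter "|r| --> oo" *)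
Definition at_infty : set_system 'rV[R]_d :=
  filter_from [set: R] (fun M => [set r | M < enorm r]).

Global Instance at_infty_filter : Filter at_infty.
Proof.
apply: filter_from_filter; first by exists 0.
move=> M N _ _; exists (Num.max M N) => // r /=.
by rewrite gt_max => /andP[].
Qed.

Canonical at_infty_filter_on := FilterType at_infty at_infty_filter.

Definition gradient (f : 'rV[R]_d -> R) (x : 'rV[R]_d) : 'rV[R]_d :=
  \row_(i < d) 'D_(delta_mx 0 i : 'rV[R]_d) (f : 'rV[R]_d -> R^o) x.

Definition divergence (F : 'rV[R]_d -> 'rV[R]_d) (x : 'rV[R]_d) : R :=
  \sum_(i < d)
    'D_(delta_mx 0 i : 'rV[R]_d) ((fun y => F y 0 i) : 'rV[R]_d -> R^o) x.

Definition C1_field (F : 'rV[R]_d -> 'rV[R]_d) : Prop :=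
  (forall x, differentiable F x) /\ continuous (fun x => 'J F x).

Definition conservative (F : 'rV[R]_d -> 'rV[R]_d) : Prop :=
  exists phi : 'rV[R]_d -> R, forall x,
    differentiable (phi : 'rV[R]_d -> R^o) x /\ F x = gradient phi x.

Definition nonneg_definite (A : 'M[R]_d) : Prop :=
  A^T = A /\ forall v, 0 <= dotp (v *m A) v.

End Euclidean.

Arguments at_infty {R d}.

Section Admissible.
Context {R : realType} {d : nat}.
Implicit Types psi : 'rV[R]_d -> 'rV[R]_d.

(* Only the values of delta on [0, +oo[ matter. *)
Definition radial_bound psi (delta : R -> R) : Prop :=
  [/\ {within `[0, +oo[, continuous delta},
      forall r, 0 <= r -> 0 <= delta r,
      delta r @[r --> +oo] --> 0 &
      forall r : 'rV[R]_d, r != 0 ->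
        enorm (psi r - (enorm r)^-1 *: r) <= delta (enorm r)].

(* For d = 1 the Jacobian 'J psi r is the 1x1 matrix of psi'(r), and the
   coordinatewise order is the order of the line. The norm on matrices
   underlying the Landau notations is the maximum of the absolute values of the
   entries. *)
Definition admissible psi : Prop :=
  [/\ C1_field psi,
      psi 0 = 0,
      exists delta : R -> R, radial_bound psi delta,
      d = 1%N ->
        [/\ forall r, psi (- r) = - psi r,
            forall x y : 'rV[R]_d, (forall i, x 0 i <= y 0 i) ->
              forall i, psi x 0 i <= psi y 0 i &
            (fun r => 'J psi r) =o_at_infty (fun r => (enorm r)^-1 : R^o)] &
      (1 < d)%N ->
        [/\ conservative psi,
            forall r, psi (- r) = - psi r,
            forall r, nonneg_definite ('J psi r) &
            (fun r => 'J psi r) =O_at_infty (fun r => (enorm r)^-1 : R^o)]].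

End Admissible.

Section Legendre.
Context {R : realType} {d : nat}.
Implicit Types k f : 'rV[R]_d -> \bar R.

(* Used for k >= 0 only, where no indeterminate form oo - oo occurs. *)
Definition econvex k : Prop :=
  forall (x y : 'rV[R]_d) (t : R), 0 <= t <= 1 ->
    (k (t *: x + (1 - t) *: y)%R <= t%:E * k x + (1 - t)%:E * k y)%E.

Definition legendre k (p : 'rV[R]_d) : \bar R :=
  ereal_sup [set ((dotp p v)%:E - k v)%E | v in [set: 'rV[R]_d]].

Definition edifferentiable f (x : 'rV[R]_d) : Prop :=
  (\forall y \near x, f y \is a fin_num) /\
  differentiable ((fun y => fine (f y)) : 'rV[R]_d -> R^o) x.

Definition egradient f (x : 'rV[R]_d) : 'rV[R]_d :=
  gradient (fun y => fine (f y)) x.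

End Legendre.

Section Equation.
Context {R : realType} {d : nat}.

(* u is a positive classical solution of u_t = div J on ]0, +oo[ x R^d *)
Definition solves (u : R -> 'rV[R]_d -> R) (J : R -> 'rV[R]_d -> 'rV[R]_d) :
    Prop :=
  forall (t : R) (x : 'rV[R]_d), 0 < t ->
    [/\ 0 < u t x,
        derivable ((u^~ x) : R -> R^o) t 1,
        differentiable (u t : 'rV[R]_d -> R^o) x,
        differentiable (J t) x &
        derive1 ((u^~ x) : R -> R^o) t = divergence (J t) x].

End Equation.

(* Main.v *)
(* A potential phi of psi exists (by hypothesis for d > 1, as a primitive for
   d = 1) and is convex because psi is monotone, i.e. it lies above its tangents.
   Take k := (s phi)^*; testing the supremum defining k^* p at v = s psi p, the
   tangent inequality alone gives k^* = s phi. Since psi is asymptotically the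
   radial unit field, phi q = |q| + o(|q|), so q.v - s phi q is bounded above
   for |v| < s and unbounded for |v| > s. On |v| = s, integrating psi along the
   ray through q shows |q| - phi q to be at most the integral of delta. *)
Require Import Defs.
From mathcomp Require Import ring lra.

Local Open Scope classical_set_scope.
Local Open Scope ring_scope.

(** * Euclidean inner product and norm *)

Section DotProduct.
Context {R : realType} {d : nat}.
Implicit Types u v w : 'rV[R]_d.

Lemma dotpC u v : dotp u v = dotp v u.
Proof. by apply: eq_bigr => i _; rewrite mulrC. Qed.

Lemma dotpDl u v w : dotp (u + v) w = dotp u w + dotp v w.
Proof.
by rewrite /dotp -big_split/=; apply: eq_bigr => i _; rewrite mxE mulrDl.
Qed.

Lemma dotpZl a u v : dotp (a *: u) v = a * dotp u v.
Proof. by rewrite /dotp mulr_sumr; apply: eq_bigr => i _; rewrite mxE mulrA. Qed.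

Lemma dotpDr u v w : dotp w (u + v) = dotp w u + dotp w v.
Proof. by rewrite dotpC dotpDl !(dotpC w). Qed.

Lemma dotpZr a u v : dotp u (a *: v) = a * dotp u v.
Proof. by rewrite dotpC dotpZl dotpC. Qed.

Lemma dotpBl u v w : dotp (u - v) w = dotp u w - dotp v w.
Proof. by rewrite -scaleN1r dotpDl dotpZl mulN1r. Qed.

Lemma dotpBr u v w : dotp w (u - v) = dotp w u - dotp w v.
Proof. by rewrite dotpC dotpBl !(dotpC w). Qed.

Lemma dotp0l u : dotp 0 u = 0.
Proof. by rewrite -(scale0r u) dotpZl mul0r. Qed.

Lemma dotp_ge0 u : 0 <= dotp u u.
Proof. by apply: sumr_ge0 => i _; rewrite -expr2 sqr_ge0. Qed.

Lemma enorm_ge0 u : 0 <= enorm u.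
Proof. exact: sqrtr_ge0. Qed.

Lemma sqr_enorm u : enorm u ^+ 2 = dotp u u.
Proof. by rewrite sqr_sqrtr// dotp_ge0. Qed.

Lemma enorm_eq0 u : (enorm u == 0) = (u == 0).
Proof.
rewrite -sqrf_eq0 sqr_enorm; apply/eqP/eqP => [/eqP|->]; last exact: dotp0l.
rewrite psumr_eq0 => [/allP u0|i _]; last by rewrite -expr2 sqr_ge0.
apply/rowP => i; rewrite mxE; apply/eqP.
by have := u0 i (mem_index_enum i); rewrite mulf_eq0 orbb.
Qed.

Lemma enormZ a u : enorm (a *: u) = `|a| * enorm u.
Proof.
by rewrite /enorm dotpZl dotpZr mulrA -expr2 sqrtrM ?sqr_ge0// sqrtr_sqr.
Qed.

Lemma ge0_enormZ a u : 0 <= a -> enorm (a *: u) = a * enorm u.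
Proof. by move=> a0; rewrite enormZ ger0_norm. Qed.

(** Cauchy-Schwarz: the square of the norm of [enorm v *: u - enorm u *: v] is nonnegative and
    equals [2 |u| |v| (|u| |v| - u.v)]. *)
Lemma dotp_le_enorm u v : dotp u v <= enorm u * enorm v.
Proof.
have [->|u0] := eqVneq u 0; first by rewrite dotp0l mulr_ge0 ?enorm_ge0.
have [->|v0] := eqVneq v 0.
  by rewrite dotpC dotp0l mulr_ge0 ?enorm_ge0.
have pu : 0 < enorm u by rewrite lt_def enorm_eq0 u0 enorm_ge0.
have pv : 0 < enorm v by rewrite lt_def enorm_eq0 v0 enorm_ge0.
have := dotp_ge0 (enorm v *: u - enorm u *: v).
rewrite !(dotpBl, dotpBr, dotpZl, dotpZr) (dotpC v u) -!sqr_enorm.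
rewrite (_ : _ - _ = (enorm u * enorm v) * (enorm u * enorm v - dotp u v) *+ 2).
  by rewrite pmulrn_lge0// pmulr_rge0 ?mulr_gt0// subr_ge0.
by ring.
Qed.

End DotProduct.

Lemma enorm_normalize (R : realType) (d : nat) (v : 'rV[R]_d) : v != 0 ->
  enorm ((enorm v)^-1 *: v) = 1.
Proof.
by move=> v0; rewrite ge0_enormZ ?invr_ge0 ?enorm_ge0// mulVf// enorm_eq0.
Qed.

(** * Derivatives along lines *)

Section LineDerivative.
Context {R : realType}.

(** Both difference quotients coincide term by term, so no chain rule is involved and derivability
    in the single direction [w] suffices. *)
Lemma is_derive_line (V W : normedModType R) (f : V -> W) (p w : V) (t : R) :
  derivable f (p + t *: w) w ->
  is_derive t 1 (fun t => f (p + t *: w)) ('D_w f (p + t *: w)).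
Proof.
have E : (fun h => h^-1 *: (f (p + (h *: 1 + t) *: w) - f (p + t *: w)))
    = (fun h => h^-1 *: (f (h *: w + (p + t *: w)) - f (p + t *: w))).
  apply/funext => h; congr (_ *: (f _ - _)).
  by rewrite scalerDl addrCA; congr (_ + _); rewrite [h *: 1]mulr1.
move=> df; split; last by rewrite /derive /= E.
by rewrite /derivable /= E.
Qed.

Lemma derive_gradient (d : nat) (f : 'rV[R]_d -> R) (x w : 'rV[R]_d) :
  differentiable (f : 'rV[R]_d -> R^o) x ->
  'D_w (f : 'rV[R]_d -> R^o) x = dotp (gradient f x) w.
Proof.
move=> df; rewrite deriveE// {1}(row_sum_delta w) linear_sum /dotp.
apply: eq_bigr => i _; rewrite mxE linearZ /= deriveE//.
by rewrite mulrC.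
Qed.

Lemma is_derive_dotp_line (d : nat) (F : 'rV[R]_d -> 'rV[R]_d)
    (p w v : 'rV[R]_d) (t : R) : differentiable F (p + t *: w) ->
  is_derive t 1 (fun t => dotp (F (p + t *: w)) v : R^o)
    (dotp (w *m 'J F (p + t *: w)) v).
Proof.
move=> dF; have [dl El] := is_derive_line (@diff_derivable _ _ _ _ _ w dF).
move: El; rewrite derive_mx// => El.
(* Written as a sum of scalings, the product can be differentiated coordinate by coordinate. *)
have dotpE u : dotp u v = \sum_(i < d) v 0 i *: (u 0 i : R^o).
  by apply: eq_bigr => i _; rewrite mulrC.
rewrite dotpE (_ : (fun t => _) =
    \sum_(i < d) (fun t => v 0 i *: (F (p + t *: w) 0 i : R^o))); last first.
  by apply/funext => x; rewrite fct_sumE dotpE.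
apply: is_derive_sum => i; apply: is_deriveZ; split.
  by move/derivable_mxP : dl; exact.
by rewrite -deriveEjacobian// -El mxE.
Qed.

End LineDerivative.

(** * Monotone fields and convexity of their potentials *)

Section ConvexPotential.
Context {R : realType} {d : nat}.
Variables (F : 'rV[R]_d -> 'rV[R]_d) (f : 'rV[R]_d -> R).
Hypothesis df : forall x, differentiable (f : 'rV[R]_d -> R^o) x.
Hypothesis gradf : forall x, F x = gradient f x.
Hypothesis monoF : forall x y, 0 <= dotp (F y - F x) (y - x).

Lemma is_derive_potential_line (p w : 'rV[R]_d) (t : R) :
  is_derive t 1 (fun t => f (p + t *: w) : R^o) (dotp (F (p + t *: w)) w).
Proof.
by rewrite gradf -derive_gradient//; apply/is_derive_line/diff_derivable.
Qed.

(** The mean value theorem on the segment gives [f q - f p = F (p + c w).w] with [0 < c];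
    monotonicity between [p] and [p + c w], divided by [c], compares this with [F p.w]. *)
Lemma potential_tangent_le (p q : 'rV[R]_d) : f p + dotp (F p) (q - p) <= f q.
Proof.
set w := q - p.
have dfl := is_derive_potential_line p w.
have [|c] := MVT ltr01 (fun t _ => dfl t).
  apply: continuous_subspaceT => t.
  by apply/differentiable_continuous/derivable1_diffP; have [] := dfl t.
rewrite in_itv/= => /andP[c0 _].
rewrite scale0r scale1r addr0 subr0 mulr1 (_ : p + w = q) => [fqp|]; last first.
  by rewrite addrC subrK.
rewrite addrC -lerBrDr fqp -subr_ge0 -dotpBl.
have := monoF p (p + c *: w).
by rewrite [p + _]addrC addrK dotpZr pmulr_rge0.
Qed.

End ConvexPotential.

(** Mean value theorem for [t |-> F (x + t w).w], whose derivative is the quadratic form of the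
    Jacobian at [w]. *)
Lemma nonneg_jacobian_monotone (R : realType) (d : nat)
    (F : 'rV[R]_d -> 'rV[R]_d) :
  (forall x, differentiable F x) -> (forall x, nonneg_definite ('J F x)) ->
  forall x y, 0 <= dotp (F y - F x) (y - x).
Proof.
move=> dF JF x y; set w := y - x.
have dFl t := @is_derive_dotp_line R d F x w w t (dF _).
have [|c _] := MVT ltr01 (fun t _ => dFl t).
  apply: continuous_subspaceT => t.
  by apply/differentiable_continuous/derivable1_diffP; have [] := dFl t.
rewrite scale0r scale1r addr0 subr0 mulr1 (_ : x + w = y); last first.
  by rewrite addrC subrK.
rewrite -dotpBl => ->.
by have [_] := JF (x + c *: w); exact.
Qed.

(** * Primitives of continuous functions on the whole line *)

Section Primitive.
Context {R : realType}.
Let mu := @lebesgue_measure R.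

(** The integral from [-oo] converges because on []-oo, x + 1]] the integrand lives on the compact
    [[0, x + 1]]. *)
Lemma primitive_of_nonneg_support (f : R -> R) : continuous f ->
  (forall x, x <= 0 -> f x = 0) ->
  exists F : R -> R, forall x : R, is_derive x 1 (F : R -> R^o) (f x).
Proof.
move=> cf f0; exists (fun x => (\int[mu]_(t in [set` `]-oo, x]]) f t)%R) => x.
have [||//|dF EF] := @continuous_FTC1 R f -oo%O x (x + 1) _ _ _ (cf x).
- by rewrite ltrDl.
- apply/integrable_mkcond => //.
  rewrite (_ : _ \_ _ = (EFin \o f) \_ `[0, x + 1]).
    have : mu.-integrable `[0, x + 1] (EFin \o f).
      apply: continuous_compact_integrable; first exact: segment_compact.
      exact: continuous_subspaceT.
    by move/integrable_mkcond; exact.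
  apply/funext => y; rewrite !patchE !mem_setE !in_itv/=.
  have [y0|y0] := leP 0 y => //=; case: ifP => // _.
  by rewrite f0// ltW.
- by rewrite ltNyr.
split; [exact: dF | rewrite -derive1E; exact: EF].
Qed.

Lemma continuous_primitive (f : R -> R) : continuous f ->
  exists F : R -> R, forall x : R, is_derive x 1 (F : R -> R^o) (f x).
Proof.
move=> cf.
have cmax (g : R -> R) : continuous g -> continuous (fun x => g x - f 0).
  by move=> cg x; apply: cvgB; [exact: cg|exact: cvg_cst].
(* [f - f 0] is split at [0] into two parts with half-line support, so that the
   integrals from [-oo] converge. *)
have [||F1 dF1] := @primitive_of_nonneg_support (fun x => f (Num.max x 0) - f 0).
- apply: cmax => x; apply: (@continuous_comp _ _ _ (fun y : R => Num.max y 0)).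
    by apply: continuous_max; [exact: cvg_id|exact: cvg_cst].
  exact: cf.
- by move=> x x0; rewrite max_r// subrr.
have [||F2 dF2] :=
  @primitive_of_nonneg_support (fun x => f (Num.min (- x) 0) - f 0).
- apply: cmax => x; apply: (@continuous_comp _ _ _ (fun y : R => Num.min (- y) 0)).
    by apply: continuous_min; [exact: opp_continuous|exact: cvg_cst].
  exact: cf.
- by move=> x x0; rewrite min_r ?oppr_ge0// subrr.
(* The derivatives add up to [f (max x 0) + f (min x 0) - f 0], which is [f x] since one of the two
   arguments is [0] and the other is [x]. *)
exists (fun x => F1 x - F2 (- x) + f 0 * x) => x.
have dF2N := @is_derive1_comp _ F2 (fun y => - y) x _ _ (dF2 (- x)) _.
apply: is_derive_eq.
rewrite opprK /GRing.scale/= mulr1 mulrN1 opprK.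
have [x0|x0] := leP x 0.
all: by ring.
Qed.

End Primitive.

(** * Growth of the potential at infinity *)

Section Growth.
Context {R : realType} {d : nat}.
Variables (psi : 'rV[R]_d -> 'rV[R]_d) (phi : 'rV[R]_d -> R).
Hypothesis dphi : forall x, differentiable (phi : 'rV[R]_d -> R^o) x.
Hypothesis grad_phi : forall x, psi x = gradient phi x.
Hypothesis psi_mono : forall x y, 0 <= dotp (psi y - psi x) (y - x).
Hypothesis psi0 : psi 0 = 0.
Hypothesis phi0 : phi 0 = 0.
Variable delta : R -> R.
Hypothesis psi_delta : radial_bound psi delta.

Let tangent_le := potential_tangent_le dphi grad_phi psi_mono.

Lemma potential_ge0 q : 0 <= phi q.
Proof. by have := tangent_le 0 q; rewrite phi0 psi0 dotp0l addr0. Qed.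

(** At [t e] the radial unit field is [e], so the quantity is [u.e] with [enorm u <= delta t];
    Cauchy-Schwarz for [u] and [- u] bounds it on both sides. *)
Lemma radial_component (t : R) (e : 'rV[R]_d) : 0 < t -> enorm e = 1 ->
  `|dotp (psi (t *: e)) e - 1| <= delta t.
Proof.
move=> t0 e1; have [_ _ _ /(_ (t *: e))] := psi_delta.
rewrite ge0_enormZ ?(ltW t0)// e1 mulr1 scalerA mulVf ?gt_eqF// scale1r.
rewrite -enorm_eq0 enormZ e1 mulr1 normr_eq0 gt_eqF// => /(_ isT).
apply: le_trans; set u := (X in _ <= enorm X).
have -> : dotp (psi (t *: e)) e - 1 = dotp u e.
  by rewrite dotpBl -sqr_enorm e1 expr1n.
have le_dotp w : dotp w e <= enorm w.
  by have := dotp_le_enorm w e; rewrite e1 mulr1.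
rewrite ler_norml lerNl -mulN1r -dotpZl le_dotp andbT (le_trans (le_dotp _))//.
by rewrite enormZ normrN normr1 mul1r.
Qed.

(** Beyond radius [M], [phi] lies above its tangent at the point of norm [M] on the ray of [q],
    whose slope along the ray is at least [1 - delta M]. Within radius [M] the left side is
    nonpositive. *)
Lemma potential_ge (M : R) (q : 'rV[R]_d) : 0 < M -> delta M <= 1 ->
  (1 - delta M) * (enorm q - M) <= phi q.
Proof.
move=> M0 dM1; have [qM|Mq] := leP (enorm q) M.
  apply: le_trans (potential_ge0 q).
  by rewrite mulr_ge0_le0 ?subr_ge0 ?subr_le0.
have q0 : q != 0 by rewrite -enorm_eq0 gt_eqF// (lt_trans M0).
have e1 := enorm_normalize q0; set e := _ *: q in e1.
have qE : q = enorm q *: e by rewrite scalerA mulfV ?scale1r// enorm_eq0.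
apply: le_trans (tangent_le (M *: e) q).
rewrite ler_wpDl ?potential_ge0// {2}qE -scalerBl dotpZr mulrC.
rewrite ler_wpM2l ?subr_ge0 ?(ltW Mq)//.
by have := radial_component M0 e1; rewrite ler_norml => /andP[]; lra.
Qed.

(** The tangent at [t e], evaluated at the origin, gives [phi (t e) <= t psi (t e).e]. *)
Lemma potential_le (t : R) (e : 'rV[R]_d) : 0 < t -> enorm e = 1 ->
  phi (t *: e) <= t * (1 + delta t).
Proof.
move=> t0 e1; have := tangent_le (t *: e) 0.
rewrite phi0 sub0r -scaleN1r scalerA mulN1r dotpZr.
have := radial_component t0 e1; rewrite ler_norml => /andP[_].
rewrite lerBlDl => h; have := ler_wpM2l (ltW t0) h; lra.
Qed.

(** By the fundamental theorem of calculus, [t - phi (t e)] is the integral over [[0, t]] of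
    [1 - psi (x e).e], which is at most [delta x] for [x > 0]. *)
Lemma potential_ge_integral (t : R) (e : 'rV[R]_d) :
  C1_field psi -> 0 < t -> enorm e = 1 ->
  lebesgue_measure.-integrable `[0, +oo[ (EFin \o delta) ->
  ((t - phi (t *: e))%:E <=
    \int[lebesgue_measure]_(x in `[0%R, +oo[) (delta x)%:E)%E.
Proof.
move=> [dpsi _] t0 e1 idelta.
pose f x : R := 1 - dotp (psi (x *: e)) e.
pose F x : R := x - phi (x *: e).
have dline (x : R) : is_derive x 1 (fun x => dotp (psi (x *: e)) e : R^o)
    (dotp (e *m 'J psi (x *: e)) e).
  have := @is_derive_dotp_line R d psi 0 e e x.
  rewrite add0r; under eq_fun do rewrite add0r; apply; exact: dpsi.
have cf : continuous f.
  move=> x; apply: cvgB; first exact: cvg_cst.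
  by have [/derivable1_diffP/differentiable_continuous + _] := dline x; exact.
have dF (x : R) : is_derive x 1 (F : R -> R^o) (f x).
  have := is_derive_potential_line dphi grad_phi 0 e x.
  rewrite add0r; under eq_fun do rewrite add0r; move=> h.
  exact: is_deriveB.
have cF x : F y @[y --> x] --> F x.
  by have [/derivable1_diffP/differentiable_continuous + _] := dF x; exact.
have := @continuous_FTC2 R f F 0 t t0 (continuous_subspaceT cf).
rewrite /= [F t]/F [F 0]/F scale0r phi0 !subr0 oppr0 adde0 => <-; last 2 first.
- split; [by move=> x _; have [] := dF x | |].
  + exact: cvg_at_right_filter.
  + exact: cvg_at_left_filter.
- by move=> x _; rewrite derive1E; have [] := dF x.
have [_ delta0 _ _] := psi_delta.
have if_ : lebesgue_measure.-integrable `[0, t] (EFin \o f).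
  apply: continuous_compact_integrable; first exact: segment_compact.
  exact: continuous_subspaceT.
(* [radial_component] needs a positive radius, so the endpoint [0], a null set, is removed. *)
have if' : lebesgue_measure.-integrable `]0, t] (EFin \o f).
  apply: integrableS if_ => // x /=.
  by rewrite !in_itv/= => /andP[/ltW-> ->].
rewrite -integral_itv_obnd_cbnd; last by have /integrableP[] := if'.
have idelta' : lebesgue_measure.-integrable `]0, t] (EFin \o delta).
  apply: integrableS idelta => // x /=.
  by rewrite !in_itv/= andbT => /andP[/ltW].
apply: (@le_trans _ _ (\int[lebesgue_measure]_(x in `]0%R, t]) (delta x)%:E)%E).
  apply: le_integral => // x; rewrite inE/= in_itv/= => /andP[x0 _].
  have := radial_component x0 e1; rewrite lee_fin ler_norml => /andP[+ _].
  by rewrite /f; lra.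
apply: ge0_subset_integral => //.
- by have /integrableP[] := idelta.
- by move=> x /=; rewrite in_itv/= andbT lee_fin; exact: delta0.
- by move=> x /=; rewrite !in_itv/= andbT => /andP[/ltW].
Qed.

End Growth.

(** * Convexity and biconjugation for the Legendre transform *)

Section LegendreTransform.
Context {R : realType} {d : nat}.
Variable f : 'rV[R]_d -> R.

Lemma legendre_ge (p v : 'rV[R]_d) :
  ((dotp p v - f v)%:E <= legendre (EFin \o f) p)%E.
Proof. by apply: ereal_sup_ubound; exists v => //=; rewrite EFinB. Qed.

Lemma legendre_le (p : 'rV[R]_d) (c : \bar R) :
  (forall v, ((dotp p v - f v)%:E <= c)%E) -> (legendre (EFin \o f) p <= c)%E.
Proof. by move=> h; apply: ge_ereal_sup => _ [v _ <-]; rewrite -EFinB. Qed.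

(** A supremum of affine functions, one for each [v]. *)
Lemma econvex_legendre : econvex (legendre (EFin \o f)).
Proof.
move=> x y t /andP[t0 t1]; apply: legendre_le => v.
rewrite dotpDl !dotpZl.
rewrite (_ : _ - _ = t * (dotp x v - f v) + (1 - t) * (dotp y v - f v)).
  by rewrite EFinD !EFinM leeD// lee_wpmul2l ?lee_fin ?subr_ge0// legendre_ge.
by ring.
Qed.

(** The upper bound is the Fenchel-Young inequality. For the lower one the supremum is tested at
    [F p]: the tangent inequality bounds the conjugate there by [p.F p - f p]. *)
Lemma biconjugate (F : 'rV[R]_d -> 'rV[R]_d) :
  (forall p q, f p + dotp (F p) (q - p) <= f q) ->
  legendre (legendre (EFin \o f)) = EFin \o f.
Proof.
move=> tangent; apply/funext => p; apply/eqP; rewrite eq_le; apply/andP; split.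
  apply: ge_ereal_sup => _ [v _ <-] /=; have := legendre_ge v p.
  case: (legendre _ v) => [r| |] //=; last by rewrite leNye.
  by rewrite -EFinB !lee_fin dotpC => h; lra.
apply: (@le_trans _ _ ((dotp p (F p))%:E - legendre (EFin \o f) (F p))%E).
  rewrite /= (_ : f p = dotp p (F p) - (dotp p (F p) - f p)); last by ring.
  rewrite EFinB leeB//; apply: legendre_le => v.
  have := tangent p v; rewrite dotpBr lee_fin (dotpC p); lra.
by apply: ereal_sup_ubound; exists (F p).
Qed.

End LegendreTransform.

(** * Potentials of admissible fields *)

Lemma gradientZ (R : realType) (d : nat) (c : R) (f : 'rV[R]_d -> R) x :
  differentiable (f : 'rV[R]_d -> R^o) x ->
  gradient (fun y => c * f y) x = c *: gradient f x.
Proof.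
move=> df; apply/rowP => i; rewrite !mxE.
exact: (@deriveZ _ _ _ (f : 'rV[R]_d -> R^o) c _ _ (diff_derivable df)).
Qed.

(** The potential is a primitive of the single component of [psi], composed with the coordinate
    map. *)
Lemma potential_dim1 (R : realType) (psi : 'rV[R]_1 -> 'rV[R]_1) :
  continuous psi -> conservative psi.
Proof.
move=> cpsi; pose f (t : R) : R := psi (t *: const_mx 1) 0 0.
have cf : continuous f.
  move=> t; apply: (@continuous_comp _ _ _
    (fun t : R => psi (t *: const_mx 1)) (fun M : 'rV[R]_1 => M 0 0 : R)).
    by apply: continuous_comp; [exact: scalel_continuous|exact: cpsi].
  exact: coord_continuous.
have [G dG] := continuous_primitive cf.
have dG' x : differentiable (G : R -> R^o) x.
  by apply/derivable1_diffP; have [] := dG x.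
have dc (x : 'rV[R]_1) := @differentiable_coord R 1 1 x 0 0.
exists (fun x => G (x 0 0)) => x; split.
  exact: differentiable_comp (dc x) (dG' _).
apply/rowP => i; rewrite mxE !ord1 deriveE; last first.
  exact: differentiable_comp (dc x) (dG' _).
rewrite (diff_comp (dc x) (dG' _)) /= -(deriveE _ (dc x)).
(* Differentiating the identity shows that the coordinate has derivative [1] along the basis
   vector. *)
have /= := @derive_mx R _ 1 1 id x (delta_mx 0 0) (@derivable_id _ _ _ _).
rewrite derive_id => /matrixP/(_ 0 0); rewrite !mxE/= => <-.
rewrite -deriveE//; have [_ ->] := dG (x 0 0); rewrite /f; congr (psi _ _ _).
by apply/rowP => j; rewrite !mxE ord1 mulr1.
Qed.

(** Merges the cases [d = 1] and [d > 1] of [admissible], so that everything after it is independent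
    of the dimension. *)
Lemma admissible_potential (R : realType) (d : nat)
    (psi : 'rV[R]_d -> 'rV[R]_d) : (1 <= d)%N -> admissible psi ->
  exists phi : 'rV[R]_d -> R,
    [/\ forall x, differentiable (phi : 'rV[R]_d -> R^o) x,
        forall x, psi x = gradient phi x, phi 0 = 0 &
        forall x y, 0 <= dotp (psi y - psi x) (y - x)].
Proof.
move=> d0 [[dpsi cpsi] _ _ adm1 adm2].
have cons : conservative psi.
  have [d1|] := ltnP 1 d; first by have [] := adm2 d1.
  case: d d0 psi dpsi {cpsi adm1 adm2} => [|[|]]// _ psi dpsi _.
  by apply: potential_dim1 => x; exact: differentiable_continuous.
have mono x y : 0 <= dotp (psi y - psi x) (y - x).
  have [d1|] := ltnP 1 d.
    by have [_ _ Jpsi _] := adm2 d1; exact: nonneg_jacobian_monotone.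
  case: d d0 psi adm1 x y {dpsi cpsi adm2 cons} => [|[|]]// _ psi /(_ erefl).
  move=> [_ mono _] x y _; rewrite /dotp big_ord1 !mxE.
  have [xy|/ltW yx] := leP (x 0 0) (y 0 0).
    by rewrite mulr_ge0 ?subr_ge0//; apply: mono => i; rewrite ord1.
  by rewrite mulr_le0 ?subr_le0//; apply: mono => i; rewrite ord1.
have [phi dphi] := cons.
(* This normalization makes [k] nonnegative later. *)
exists (fun x => phi x - phi 0); split => //; last by rewrite subrr.
- by move=> x; apply: differentiableB => //; exact: (dphi x).1.
- move=> x; rewrite (dphi x).2; apply/rowP => i; rewrite !mxE.
  have := @deriveB R _ _ (phi : _ -> R^o) (cst (phi 0)) x (delta_mx 0 i).
  rewrite derive_cst subr0 => -> //.
  by apply: diff_derivable; exact: (dphi x).1.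
Qed.

(** * Construction of the cost and its finiteness domain *)

Theorem proposition1 (R : realType) (d : nat) (s L : R)
    (psi : 'rV[R]_d -> 'rV[R]_d)
    (hd : (1 <= d)%N) (hs : 0 < s) (hL : 0 < L) (hpsi : admissible psi) :
  exists k : 'rV[R]_d -> \bar R,
    (forall v, (0 <= k v)%E) /\
    econvex k /\
    (forall r, edifferentiable (legendre k) r /\
               s *: psi r = egradient (legendre k) r) /\
    (forall u : R -> 'rV[R]_d -> R,
      solves u (fun t x =>
        (s * u t x) *: psi ((u t x)^-1 *: (L *: gradient (u t) x))) <->
      solves u (fun t x =>
        u t x *: egradient (legendre k)
                   ((u t x)^-1 *: (L *: gradient (u t) x)))) /\
    (forall v, enorm v < s -> k v \is a fin_num) /\
    (forall v, s < enorm v -> k v = +oo%E) /\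
    (forall delta : R -> R, radial_bound psi delta ->
      lebesgue_measure.-integrable `[0, +oo[ (EFin \o delta) ->
      forall v, enorm v = s -> k v \is a fin_num).
Proof.
have [phi [dphi grad_phi phi0 mono]] := admissible_potential hd hpsi.
have [C1 psi0 [delta deltaP] _ _] := hpsi.
pose f x := s * phi x.
have tangent p q : f p + dotp (s *: psi p) (q - p) <= f q.
  rewrite dotpZl /f -mulrDr ler_pM2l//.
  exact: (potential_tangent_le dphi grad_phi mono).
have kk := biconjugate tangent.
pose k := legendre (EFin \o f).
have k_ge0 v : (0 <= k v)%E.
  apply: le_trans (legendre_ge f v 0).
  by rewrite /f phi0 mulr0 subr0 dotpC dotp0l.
(* As [k] is nonnegative, a finite upper bound is all that finiteness requires. *)
have k_fin v c : (k v <= c)%E -> c \is a fin_num -> k v \is a fin_num.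
  move=> kc cfin; rewrite ge0_fin_numE// (le_lt_trans kc)// ltey_eq cfin//.
have fineE : (fun y => fine (legendre k y)) = f by rewrite /k kk.
have gradE r : s *: psi r = egradient (legendre k) r.
  by rewrite /egradient fineE gradientZ// grad_phi.
have split_dir v : v != 0 ->
    exists2 e : 'rV[R]_d, enorm e = 1 & v = enorm v *: e.
  move=> v0; exists ((enorm v)^-1 *: v); first exact: enorm_normalize.
  by rewrite scalerA mulfV ?scale1r// enorm_eq0.
have delta_small (e : R) : 0 < e -> exists2 M, 0 < M &
    forall t, M <= t -> delta t < e.
  move=> e0; have [_ _ dl _] := deltaP.
  have [M [_ MP]] : \forall t \near +oo, delta t < e.
    by move: dl => /cvgr_lt; exact.
  (* The neighborhood of [+oo] only controls [t > M]; adding [1] turns [<=] into [<], and the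
     maximum with [1] makes the threshold positive. *)
  exists (Num.max 1 (M + 1)); first by rewrite lt_max ltr01.
  move=> t; rewrite ge_max => /andP[_ Mt]; apply: MP.
  by rewrite (lt_le_trans _ Mt)// ltrDl.
exists k; split => //; split; first exact: econvex_legendre.
split=> [r|]; last split=> [u|].
- split=> //; split.
    by apply: filterS (@filterT _ (nbhs r) _) => y _; rewrite /k kk.
  by rewrite fineE; exact: differentiableZ.
(* The two fluxes are the same function, so the equations are identical. *)
- rewrite (_ : (fun t x => (s * u t x) *: _) = (fun t x => u t x *:
    egradient (legendre k) ((u t x)^-1 *: (L *: gradient (u t) x))))//.
  by apply/funext => t; apply/funext => x; rewrite -gradE scalerA mulrC.
split=> [v vs|]; last split=> [v sv|delta' delta'P idelta v vs].
(* This threshold gives [|v| <= s (1 - delta M)]. Then [v.q - f q] is at most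
   [|v||q| - s (1 - delta M) (|q| - M)], hence at most [s (1 - delta M) M]. *)
- have [|M M0 MP] := delta_small (1 - enorm v / s).
    by rewrite subr_gt0 ltr_pdivrMr// mul1r.
  have dM := ltW (MP _ (lexx M)).
  have dM1 : delta M <= 1.
    by rewrite (le_trans dM)// gerBl divr_ge0// ?enorm_ge0// ltW.
  apply: (k_fin _ (s * (1 - delta M) * M)%:E) => //; apply: legendre_le => q.
  rewrite lee_fin.
  have h1 := dotp_le_enorm v q.
  have h2 := potential_ge dphi grad_phi mono psi0 phi0 deltaP q M0 dM1.
  have h3 : enorm v <= s * (1 - delta M).
    by rewrite -ler_pdivrMl// mulrC; lra.
  have h4 := ler_wpM2r (enorm_ge0 q) h3.
  rewrite -(ler_pM2l hs) in h2.
  by rewrite /f; lra.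
- have v0 : v != 0 by rewrite -enorm_eq0 gt_eqF// (lt_trans hs).
  have [e e1 vE] := split_dir v v0.
  (* Half of the excess absorbs the error: along [e], [v.(t e) = t (s + 2 c)] while
     [f (t e) <= t (s + c)] once [delta t < c / s]. The remaining [t c] reaches [A] when
     [t >= A / c]. *)
  pose c := (enorm v - s) / 2.
  have c0 : 0 < c by rewrite divr_gt0// subr_gt0.
  have [|M M0 MP] := delta_small (c / s); first by rewrite divr_gt0.
  apply/eqyP => A A0; pose t := Num.max M (A / c).
  have t0 : 0 < t by rewrite lt_max M0.
  apply: le_trans (legendre_ge f v (t *: e)).
  have h1 := potential_le dphi grad_phi mono phi0 deltaP t0 e1.
  have : delta t < c / s by apply: MP; rewrite le_max lexx.
  rewrite ltr_pdivlMr// => /ltW h2.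
  have h3 : A <= t * c by rewrite -ler_pdivrMr// le_max lexx orbT.
  have h4 := ler_wpM2l (ltW t0) h2.
  rewrite -(ler_pM2l hs) in h1.
  have cE : enorm v = s + 2 * c by rewrite /c; field.
  rewrite lee_fin dotpZr {1}vE dotpZl -sqr_enorm e1 expr1n mulr1 cE.
  by rewrite /f; lra.
(* Here [v.q <= s |q|], so [v.q - f q <= s (|q| - phi q) <= s I] uniformly in [q]. The integrable
   bound [delta'] may differ from the [delta] fixed above; [q = 0] is separate, having no
   direction. *)
- set I := (\int[lebesgue_measure]_(x in `[0%R, +oo[) (delta' x)%:E)%E.
  have Ifin : I \is a fin_num by exact: integrable_fin_num.
  have I0 : 0 <= fine I.
    apply: fine_ge0; apply: integral_ge0 => x /=.
    rewrite in_itv/= andbT lee_fin; have [_ + _ _] := delta'P; exact.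
  apply: (k_fin _ (s * fine I)%:E) => //; apply: legendre_le => q.
  rewrite lee_fin; have [->|q0] := eqVneq q 0.
    by rewrite /f phi0 mulr0 subr0 dotpC dotp0l mulr_ge0// ltW.
  have [e e1 qE] := split_dir q q0.
  have t0 : 0 < enorm q by rewrite lt_def enorm_eq0 q0 enorm_ge0.
  have := potential_ge_integral dphi grad_phi phi0 delta'P C1 t0 e1 idelta.
  rewrite -/I -(fineK Ifin) lee_fin -qE => h.
  rewrite -(ler_pM2l hs) in h.
  have := dotp_le_enorm v q; rewrite vs /f; lra.
Qed.
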